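(* Let $(\mathcal C,\mathcal S,E,F)$ be a bipartite matching structure. The matching policies First Come First Served (FCFS), Last Come First Served (LCFS), Random (RAND) and Match the Longest (ML) are sub-additive; that is, for $\phi$ any of these policies, for all $\mathbf c',\mathbf c''\in\mathcal C^*$, $\mathbf s',\mathbf s''\in\mathcal S^*$, $\boldsymbol\sigma',\boldsymbol\sigma''\in\mathbb S^*$, $\boldsymbol\gamma',\boldsymbol\gamma''\in\mathbb C^*$ with $|\mathbf c'|=|\mathbf s'|=|\boldsymbol\sigma'|=|\boldsymbol\gamma'|$ and $|\mathbf c''|=|\mathbf s''|=|\boldsymbol\sigma''|=|\boldsymbol\gamma''|$, $$|C_\phi(\mathbf c'\mathbf c'',\mathbf s'\mathbf s'',\boldsymbol\sigma'\boldsymbol\sigma'',\boldsymbol\gamma'\boldsymbol\gamma'')|\le|C_\phi(\mathbf c',\mathbf s',\boldsymbol\sigma',\boldsymbol\gamma')|+|C_\phi(\mathbf c'',\mathbf s'',\boldsymbol\sigma'',\boldsymbol\gamma'')|,$$ $$|S_\phi(\mathbf c'\mathbf c'',\mathbf s'\mathbf s'',\boldsymbol\sigma'\boldsymbol\sigma'',\boldsymbol\gamma'\boldsymbol\gamma'')|\le|S_\phi(\mathbf c',\mathbf s',\boldsymbol\sigma',\boldsymbol\gamma')|+|S_\phi(\mathbf c'',\mathbf s'',\boldsymbol\sigma'',\boldsymbol\gamma'')|.$$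
   Context: **Structure.** A bipartite matching structure is a quadruple $(\mathcal C,\mathcal S,E,F)$ where $\mathcal C$ (customer classes) and $\mathcal S$ (server classes) are disjoint non-empty finite sets, $E\subset\mathcal C\times\mathcal S$ (possible matchings) and $F\subset\mathcal C\times\mathcal S$ (possible arrivals). Standing assumptions: $(\mathcal C\cup\mathcal S,E)$ is connected, $(\mathcal C\cup\mathcal S,F)$ has no isolated vertex. Put $\mathcal S(c)=\{s:(c,s)\in E\}$, $\mathcal C(s)=\{c:(c,s)\in E\}$. **Words.** $A^*$ is the set of finite words over $A$; $|\mathbf w|$ is the length of $\mathbf w$, $|\mathbf w|_B$ the number of letters of $\mathbf w$ lying in $B$ (and $|\mathbf w|_b=|\mathbf w|_{\{b\}}$), $\mathbf w_{[i]}$ is $\mathbf w$ with its $i$-th letter deleted. $\emptyset$ denotes both the empty word and the pair of empty words. **Lists of preferences.** $\mathbb S=\prod_{c\in\mathcal C}\mathrm{Sym}(\mathcal S(c))$ and $\mathbb C=\prod_{s\in\mathcal S}\mathrm{Sym}(\mathcal C(s))$, where $\mathrm{Sym}(A)$ is the set of orderings of $A$. For $\sigma\in\mathbb S$, $\sigma(c)[k]$ is the $k$-th class of $\mathcal S(c)$ in the ordering $\sigma(c)$; similarly $\gamma(s)[k]$ for $\gamma\in\mathbb C$. **States and update.** $\mathcal U$ is the set of $(\mathbf w,\mathbf z)\in\mathcal C^*\times\mathcal S^*$ with $|\mathbf w|_i|\mathbf z|_j=0$ for all $(i,j)\in E$. When the couple $(c,s)\in\mathcal C\times\mathcal S$ with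 lists $(\sigma,\gamma)\in\mathbb S\times\mathbb C$ enters a system in state $(\mathbf w,\mathbf z)\in\mathcal U$, the policy $\phi$ chooses a position $k$ with $w_k\in\mathcal C(s)$ if $|\mathbf w|_{\mathcal C(s)}\ne0$, and a position $l$ with $z_l\in\mathcal S(c)$ if $|\mathbf z|_{\mathcal S(c)}\neq0$. The new state $(\mathbf w,\mathbf z)\odot_\phi(c,s,\sigma,\gamma)$ is: - $(\mathbf wc,\mathbf zs)$ if $|\mathbf w|_{\mathcal C(s)}=|\mathbf z|_{\mathcal S(c)}=0$ and $(c,s)\notin E$; - $(\mathbf w,\mathbf z)$ if $|\mathbf w|_{\mathcal C(s)}=|\mathbf z|_{\mathcal S(c)}=0$ and $(c,s)\in E$; - $(\mathbf w_{[k]},\mathbf z_{[l]})$ if $|\mathbf w|_{\mathcal C(s)}\ne0$ and $|\mathbf z|_{\mathcal S(c)}\neq0$; - $(\mathbf w_{[k]}c,\mathbf z)$ if $|\mathbf w|_{\mathcal C(s)}\neq0$ and $|\mathbf z|_{\mathcal S(c)}=0$; - $(\mathbf w,\mathbf z_{[l]}s)$ if $|\mathbf w|_{\mathcal C(s)}=0$ and $|\mathbf z|_{\mathcal S(c)}\ne0$. $Q_\phi(\mathbf c,\mathbf s,\boldsymbol\sigma,\boldsymbol\gamma)=(C_\phi(\mathbf c,\mathbf s,\boldsymbol\sigma,\boldsymbol\gamma),S_\phi(\mathbf c,\mathbf s,\boldsymbol\sigma,\boldsymbol\gamma))$ is the state reached from $\emptyset$ after applying successively the inputs $(c_1,s_1,\sigma_1,\gamma_1),(c_2,s_2,\sigma_2,\gamma_2),\dots$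 **Policies.** - FCFS: $k=\min\{m:w_m\in\mathcal C(s)\}$, $l=\min\{m:z_m\in\mathcal S(c)\}$ (lists irrelevant). - LCFS: $k=\max\{m:w_m\in\mathcal C(s)\}$, $l=\max\{m:z_m\in\mathcal S(c)\}$ (lists irrelevant). - RAND: $c$ is matched with an item of class $\sigma(c)[m]$, where $m$ is the smallest index such that the class $\sigma(c)[m]$ occurs in $\mathbf z$; $s$ is matched with an item of class $\gamma(s)[m]$, where $m$ is the smallest index such that $\gamma(s)[m]$ occurs in $\mathbf w$. - ML: $c$ is matched with an item of class $\sigma(c)[m]$, where $m$ is the smallest index such that $\sigma(c)[m]$ maximizes $j\mapsto|\mathbf z|_j$ over $j\in\mathcal S(c)$; $s$ is matched with an item of class $\gamma(s)[m]$, where $m$ is the smallest index such that $\gamma(s)[m]$ maximizes $i\mapsto|\mathbf w|_i$ over $i\in\mathcal C(s)$. For RAND and ML, within the chosen class a fixed rule is used, e.g. the oldest item (leftmost letter of this class). *)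

(* Defs.v *)
From mathcomp Require Import all_boot.

Set Implicit Arguments.
Unset Strict Implicit.
Unset Printing Implicit Defensive.

(* The vertex set of both graphs is C + S, which makes the two classes disjoint. *)
Definition bip_adj (C S : finType) (E : {set C * S}) : rel (C + S) :=
  fun x y => match x, y with
             | inl c, inr s | inr s, inl c => (c, s) \in E
             | _, _ => false
             end.

Record matching_structure (C S : finType) (E F : {set C * S}) : Prop := {
  customers_nonempty : 0 < #|C|;
  servers_nonempty : 0 < #|S|;
  matching_connected : forall x y : C + S, connect (bip_adj E) x y;
  arrivals_no_isolated : forall x : C + S, exists y, bip_adj F x y
}.

Definition servers_of (C S : finType) (E : {set C * S}) (c : C) : {set S} :=
  [set s | (c, s) \in E].
Definition customers_of (C S : finType) (E : {set C * S}) (s : S) : {set C} :=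
  [set c | (c, s) \in E].

Definition ordering (T : finType) (A : {set T}) : Type :=
  {l : seq T | perm_eq l (enum A)}.

(* The products of the Sym(S(c)) over c, and of the Sym(C(s)) over s. *)
Definition server_lists (C S : finType) (E : {set C * S}) : Type :=
  forall c : C, ordering (servers_of E c).
Definition customer_lists (C S : finType) (E : {set C * S}) : Type :=
  forall s : S, ordering (customers_of E s).

Definition state (C S : finType) : Type := (seq C * seq S)%type.
Definition input (C S : finType) (E : {set C * S}) : Type :=
  (C * S * server_lists E * customer_lists E)%type.

(* A policy returns the positions (k, l), counted from 0.  The update below
   reads k only if w has a letter in C(s), and l only if z has a letter in
   S(c); the values in the other cases are irrelevant. *)
Definition policy (C S : finType) (E : {set C * S}) : Type :=
  state C S -> input E -> nat * nat.

Definition delete_at (T : Type) (k : nat) (w : seq T) : seq T :=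
  take k w ++ drop k.+1 w.

(* Defined on all pairs of words.  When the policy chooses k and l with w_k in
   C(s) and z_l in S(c), the set of pairs (w, z) in which no letter of w is
   compatible with a letter of z is stable; it contains the initial state. *)
Definition update (C S : finType) (E : {set C * S}) (phi : policy E)
    (q : state C S) (a : input E) : state C S :=
  let: (w, z) := q in
  let: (c, s, sigma, gamma) := a in
  let: (k, l) := phi q a in
  match count (mem (customers_of E s)) w != 0,
        count (mem (servers_of E c)) z != 0 with
  | false, false => if (c, s) \in E then (w, z) else (rcons w c, rcons z s)
  | true, true => (delete_at k w, delete_at l z)
  | true, false => (rcons (delete_at k w) c, z)
  | false, true => (w, rcons (delete_at l z) s)
  end.

(* zip truncates to the shortest word; Q is only used on words of equal length. *)
Definition Q (C S : finType) (E : {set C * S}) (phi : policy E)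
    (cs : seq C) (ss : seq S)
    (sigmas : seq (server_lists E)) (gammas : seq (customer_lists E)) :
    state C S :=
  foldl (update phi) ([::], [::]) (zip (zip (zip cs ss) sigmas) gammas).

Definition subadditive (C S : finType) (E : {set C * S}) (phi : policy E) : Prop :=
  forall (c' c'' : seq C) (s' s'' : seq S)
         (sigma' sigma'' : seq (server_lists E))
         (gamma' gamma'' : seq (customer_lists E)),
    size c' = size s' -> size s' = size sigma' -> size sigma' = size gamma' ->
    size c'' = size s'' -> size s'' = size sigma'' ->
    size sigma'' = size gamma'' ->
    let q := Q phi (c' ++ c'') (s' ++ s'') (sigma' ++ sigma'')
               (gamma' ++ gamma'') in
    let q' := Q phi c' s' sigma' gamma' in
    let q'' := Q phi c'' s'' sigma'' gamma'' in
    size q.1 <= size q'.1 + size q''.1 /\ size q.2 <= size q'.2 + size q''.2.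

Definition FCFS (C S : finType) (E : {set C * S}) : policy E :=
  fun '(w, z) '(c, s, sigma, gamma) =>
    (find (mem (customers_of E s)) w, find (mem (servers_of E c)) z).

Definition last_pos (T : finType) (A : {set T}) (w : seq T) : nat :=
  \max_(m < size w | tnth (in_tuple w) m \in A) m.

Definition LCFS (C S : finType) (E : {set C * S}) : policy E :=
  fun '(w, z) '(c, s, sigma, gamma) =>
    (last_pos (customers_of E s) w, last_pos (servers_of E c) z).

(* A rule designating which item of a given class is taken in a word,
   for instance the oldest one: r w a = index a w. *)
Definition item_rule (T : eqType) (r : seq T -> T -> nat) : Prop :=
  forall w a, a \in w -> onth w (r w a) = Some a.

(* The position, according to r, of an item of the first class of o satisfying
   p; the default 0 is never read by the update. *)
Definition pos_of_first (T : finType) (A : {set T}) (r : seq T -> T -> nat)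
    (o : ordering A) (p : pred T) (w : seq T) : nat :=
  oapp (r w) 0 (onth (val o) (find p (val o))).

Definition rand_pos (T : finType) (A : {set T}) (r : seq T -> T -> nat)
    (o : ordering A) (w : seq T) : nat :=
  pos_of_first r o (mem w) w.

Definition RAND (C S : finType) (E : {set C * S})
    (rC : seq C -> C -> nat) (rS : seq S -> S -> nat) : policy E :=
  fun '(w, z) '(c, s, sigma, gamma) =>
    (rand_pos rC (gamma s) w, rand_pos rS (sigma c) z).

Definition ml_pos (T : finType) (A : {set T}) (r : seq T -> T -> nat)
    (o : ordering A) (w : seq T) : nat :=
  pos_of_first r o
    (fun a => [forall b in A, count_mem b w <= count_mem a w]) w.

Definition ML (C S : finType) (E : {set C * S})
    (rC : seq C -> C -> nat) (rS : seq S -> S -> nat) : policy E :=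
  fun '(w, z) '(c, s, sigma, gamma) =>
    (ml_pos rC (gamma s) w, ml_pos rS (sigma c) z).

(* Main.v *)
Require Import Defs.
From mathcomp Require Import all_boot.
From mathcomp Require Import zify.

Set Implicit Arguments.
Unset Strict Implicit.
Unset Printing Implicit Defensive.

(** Feed the second half of the inputs to two copies of the system: one starts
    from the state reached after the first half, the other from the empty
    state.  It is enough that the number of discrepancies between the two
    copies never increases.  Initially it is the total length of the state
    reached after the first half, and at each time it bounds the difference of
    the total lengths of the two states; as the two words of a reachable state
    have the same length, the bound on the total gives the bound on each word.

    A policy of the kind considered treats the two words separately: the
    arriving server takes an item of the customer word, the arriving customer
    an item of the server word.  If only one of the two copies can serve an
    arrival, then the discrepancy removed from the word that is served pays
    for the one created when the other copy stores the arrival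
    ([close_update]).  So everything reduces to one word and one service
    ([nonexpansive], [subadditive_side_policy]).

    What a discrepancy is depends on the policy.  In both cases the reason is
    the same: when the copies serve different items, at least one of these
    items is a discrepancy, and its removal compensates for the other removal.
    - For FCFS and LCFS, items are compared individually, by an alignment of
      the two words that respects arrival order.  When the copies serve
      different items, the one with the higher priority is missing from the
      other copy, otherwise the latter would have served it
      ([aligned_remove_first]).
    - For RAND and ML, only the number of items of each class matters and the
      discrepancies are counted by the l1 distance of these numbers.  When
      different classes are served, one of them has strictly more items in the
      copy that serves it ([nonexpansive_class]): under RAND because the class
      preferred by the list is absent from the other copy, under ML because
      otherwise both classes are longest in both copies and the list would
      have broken the tie in the same way. *)

(** * One word: selections and discrepancies *)

(** The position taken in the word [w] by an arrival compatible with the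
    classes in [A], whose list is [o]. *)
Definition selection (T : finType) : Type :=
  forall A : {set T}, ordering A -> seq T -> nat.

Definition serve (T : finType) (f : selection T) (A : {set T})
    (o : ordering A) (w : seq T) : seq T :=
  if has (mem A) w then delete_at (f A o w) w else w.

Definition rcons_if (T : Type) (b : bool) (w : seq T) (a : T) : seq T :=
  if b then rcons w a else w.

(** The relation [within n w w'] stands for: [w] and [w'] differ by at most [n]
    discrepancies.  In [within_serve] the Boolean sum is 1 when the arrival is
    served in exactly one of the two words; then a discrepancy must disappear,
    because the other copy is going to store the arrival. *)
Record nonexpansive (T : finType) (f : selection T)
    (within : nat -> seq T -> seq T -> Prop) : Prop := {
  select_lt_size : forall (A : {set T}) (o : ordering A) w,
    has (mem A) w -> f A o w < size w;
  within_nil : forall w, within (size w) w [::];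
  within_size : forall n w w', within n w w' -> size w <= size w' + n;
  within_rcons_if : forall n b b' a w w', within n w w' ->
    within (n + (b (+) b')) (rcons_if b w a) (rcons_if b' w' a);
  within_serve : forall (A : {set T}) (o : ordering A) n w w', within n w w' ->
    exists2 m, m + (has (mem A) w (+) has (mem A) w') <= n
             & within m (serve f o w) (serve f o w')
}.

(** * Deleting one letter *)

Section DeleteAt.
Variable T : eqType.
Implicit Types (w : seq T) (a : T).

Lemma size_delete_at k w : k < size w -> size (delete_at k w) = (size w).-1.
Proof. by move=> kw; rewrite size_cat size_takel ?size_drop; lia. Qed.

Lemma delete_atS k a w : delete_at k.+1 (a :: w) = a :: delete_at k w.
Proof. by []. Qed.

Lemma delete_at0 a w : delete_at 0 (a :: w) = w.
Proof. by rewrite /delete_at /= drop0. Qed.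

Lemma perm_delete_at k a w :
  onth w k = Some a -> perm_eq w (a :: delete_at k w).
Proof.
elim: w k => [|b w IH] [|k] //=; first by case=> ->; rewrite delete_at0.
move=> /IH wP; rewrite delete_atS.
rewrite -(perm_cons b) in wP; apply: perm_trans wP _.
by rewrite -(cat1s b) -(cat1s a) -(cat1s a) -(cat1s b) perm_catCA.
Qed.

End DeleteAt.

Lemma size_serve (T : finType) (f : selection T) within (A : {set T})
    (o : ordering A) w :
  nonexpansive f within -> size (serve f o w) + has (mem A) w = size w.
Proof.
move=> fP; rewrite /serve; case: ifP => [hw|_]; last exact: addn0.
have := select_lt_size fP o hw => lt_k.
by rewrite size_delete_at // addn1 (ltn_predK lt_k).
Qed.

(** * Non-expansive selections give sub-additive policies *)

Section SidePolicy.
Variables (C S : finType) (E : {set C * S}).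

Definition side_policy (f : selection C) (g : selection S) : policy E :=
  fun '(w, z) '(c, s, sigma, gamma) =>
    (f (customers_of E s) (gamma s) w, g (servers_of E c) (sigma c) z).

Variables (f : selection C) (g : selection S).
Variables (withinC : nat -> seq C -> seq C -> Prop)
          (withinS : nat -> seq S -> seq S -> Prop).
Hypotheses (fP : nonexpansive f withinC) (gP : nonexpansive g withinS).
Let step := update (side_policy f g).

(** Splits the update into service of the two old words followed by storage:
    an arrival that is not served is stored, unless it is matched with the
    simultaneous arrival, which happens when neither is served and the couple
    is compatible. *)
Lemma update_sideE w z c s (sigma : server_lists E) (gamma : customer_lists E) :
  let served_s := has (mem (customers_of E s)) w in
  let served_c := has (mem (servers_of E c)) z in
  let stay := [|| served_s, served_c | (c, s) \notin E] in
  step (w, z) (c, s, sigma, gamma) =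
    (rcons_if (~~ served_c && stay) (serve f (gamma s) w) c,
     rcons_if (~~ served_s && stay) (serve g (sigma c) z) s).
Proof.
rewrite /step /update /side_policy /serve -!lt0n -!has_count.
by case: has; case: has; case: (_ \in E).
Qed.

(** Each arriving couple brings one letter of each kind and each matching
    removes one letter of each kind. *)
Lemma size_update q a : size q.1 = size q.2 ->
  size (step q a).1 = size (step q a).2.
Proof.
case: q => w z; case: a => [[[c s] sigma] gamma] eq_wz.
rewrite update_sideE; move: eq_wz => /=.
have := size_serve (gamma s) w fP; have := size_serve (sigma c) z gP.
by case: has; case: has; case: (_ \in E); rewrite /= ?size_rcons; lia.
Qed.

Lemma size_run l q : size q.1 = size q.2 ->
  size (foldl step q l).1 = size (foldl step q l).2.
Proof. by elim: l q => //= a l IH q /size_update-/(_ a)/IH. Qed.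

Definition close (n : nat) (q q' : state C S) : Prop :=
  exists m1 m2, [/\ m1 + m2 <= n, withinC m1 q.1 q'.1 & withinS m2 q.2 q'.2].

(** Besides the exchange between service and storage, there is the case where
    the couple is matched together in one copy only.  The other copy then
    serves at least one of the two arrivals, and stores at most one: the
    discrepancies removed by service again cover those created by storage. *)
Lemma close_update n q q' a : close n q q' -> close n (step q a) (step q' a).
Proof.
case: q q' a => [w z] [w' z'] [[[c s] sigma] gamma].
rewrite !update_sideE => -[m1 [m2 [le_n /= ww zz]]].
have [n1 le1 ww1] := within_serve fP (gamma s) ww.
have [n2 le2 zz1] := within_serve gP (sigma c) zz.
do 2!eexists; split; last 2 first.
- exact: (within_rcons_if fP _ _ _ ww1).
- exact: (within_rcons_if gP _ _ _ zz1).
(* What is left only depends on which arrivals are served in which copy. *)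
move: le1 le2.
by do 4!case: has; case: (_ \in E) => /=; lia.
Qed.

Lemma close_run n l q q' :
  close n q q' -> close n (foldl step q l) (foldl step q' l).
Proof. by elim: l q q' => //= a l IH q q' /close_update-/(_ a)/IH. Qed.

Theorem subadditive_side_policy : subadditive (side_policy f g).
Proof.
move=> c' c'' s' s'' sg' sg'' gm' gm'' e1 e2 e3 _ _ _ /=.
rewrite /Q !zip_cat ?size_zip ?foldl_cat; try lia.
set l' := zip _ gm'; set l'' := zip _ gm''; rewrite -/step.
set q0 := foldl step ([::], [::]) l'.
have q0_bal : size q0.1 = size q0.2 by exact: size_run.
have /(close_run l'') [m1 [m2 [le_m /= ww zz]]] :
    close (size q0.1 + size q0.2) q0 ([::], [::]).
  by exists (size q0.1), (size q0.2); split;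
     rewrite //; [apply: (within_nil fP) | apply: (within_nil gP)].
have := within_size fP ww; have := within_size gP zz.
have := size_run l'' q0_bal.
have := @size_run l'' ([::], [::]) erefl.
lia.
Qed.

End SidePolicy.

(** * FCFS and LCFS: order-preserving alignments *)

(** [aligned n w w'] : some order-preserving matching of equal letters of [w]
    and [w'] leaves at most [n] letters unmatched.  The base case holds for all
    [n], so that [n] is an upper bound and not an exact count. *)
Inductive aligned (T : Type) : nat -> seq T -> seq T -> Prop :=
| aligned_nil n : aligned n [::] [::]
| aligned_both n a w w' : aligned n w w' -> aligned n (a :: w) (a :: w')
| aligned_left n a w w' : aligned n w w' -> aligned n.+1 (a :: w) w'
| aligned_right n a w w' : aligned n w w' -> aligned n.+1 w (a :: w').

Section Aligned.
Variable T : eqType.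
Implicit Types (w : seq T) (p : pred T).

Definition remove_first p w := delete_at (find p w) w.

Lemma remove_first_cons p a w :
  remove_first p (a :: w) = if p a then w else a :: remove_first p w.
Proof. by rewrite /remove_first /=; case: (p a); rewrite ?delete_at0. Qed.

Lemma remove_first_id p w : ~~ has p w -> remove_first p w = w.
Proof.
by elim: w => //= a w IH; rewrite negb_or remove_first_cons => /andP[/negPf-> /IH->].
Qed.

Lemma aligned_sym n w w' : aligned n w w' -> aligned n w' w.
Proof. by elim=> *; constructor. Qed.

Lemma aligned_succ n w w' : aligned n w w' -> aligned n.+1 w w'.
Proof. by elim=> *; constructor. Qed.

Lemma aligned_rcons_if n b b' a w w' : aligned n w w' ->
  aligned (n + (b (+) b')) (rcons_if b w a) (rcons_if b' w' a).
Proof.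
elim=> {n w w'} [n|n x w w' _|n x w w' _|n x w w' _].
- by case: b; case: b'; rewrite /= ?addn0 ?addn1; do !constructor.
all: by case: b; case: b'; rewrite /= ?addSn; constructor.
Qed.

Lemma aligned_rev n w w' : aligned n w w' -> aligned n (rev w) (rev w').
Proof.
elim=> {n w w'} [n|n a w w' _ IH|n a w w' _ IH|n a w w' _ IH]; first by constructor.
all: rewrite ?rev_cons.
- by have := aligned_rcons_if true true a IH; rewrite addn0.
- by have := aligned_rcons_if true false a IH; rewrite addn1.
- by have := aligned_rcons_if false true a IH; rewrite addn1.
Qed.

Lemma aligned_size n w w' : aligned n w w' -> size w <= size w' + n.
Proof. by elim=> //= *; lia. Qed.

Lemma aligned_nil_r w : aligned (size w) w [::].
Proof. by elim: w => [|a w IH]; constructor. Qed.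

Lemma aligned_remove_left p n w w' :
  aligned n w w' -> aligned n.+1 (remove_first p w) w'.
Proof.
elim=> {n w w'} [n|n a w w' ww IH|n a w w' ww IH|n a w w' ww IH].
- by constructor.
- by rewrite remove_first_cons; case: (p a); constructor.
- rewrite remove_first_cons; case: (p a); last by constructor.
  by do 2!apply: aligned_succ.
- by constructor.
Qed.

(** Scan the alignment up to the first letter satisfying [p] in either word.  If
    it is common to both words, it is removed from both.  Otherwise it is
    unmatched, and removing it saves one discrepancy, which pays for whatever
    is removed later from the other word. *)
Lemma aligned_remove_first p n w w' : aligned n w w' ->
  exists2 m, m + (has p w (+) has p w') <= n
           & aligned m (remove_first p w) (remove_first p w').
Proof.
have one_sided k v v' : aligned k v v' ->
    exists2 m, m + ~~ has p v' <= k.+1 & aligned m v (remove_first p v').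
  move=> vv; have [hv'|hv'] := boolP (has p v').
    exists k.+1; first by rewrite addn0.
    exact/aligned_sym/aligned_remove_left/aligned_sym.
  by exists k; rewrite ?addn1 ?remove_first_id.
elim=> {n w w'} [n|n a w w' ww IH|n a w w' ww IH|n a w w' ww IH].
- by exists n; [rewrite addn0 | constructor].
- rewrite !remove_first_cons /=; case: (p a); first by exists n; rewrite ?addn0.
  by have [m le_m] := IH; exists m => //; constructor.
- rewrite remove_first_cons /=; case: (p a); first exact: one_sided.
  by have [m le_m] := IH; exists m.+1 => //; constructor.
- rewrite remove_first_cons /=; case: (p a).
    have [m le_m /aligned_sym] := one_sided _ _ _ (aligned_sym ww).
    by exists m; rewrite // addbT.
  by have [m le_m] := IH; exists m.+1 => //; constructor.
Qed.

End Aligned.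

Section SelectionByAge.
Variable T : finType.

Definition first_selection : selection T := fun A _ w => find (mem A) w.
Definition last_selection : selection T := fun A _ w => last_pos A w.

(** The test of presence in [serve] disappears, because [find] then points past
   the end of the word and [remove_first] does nothing. *)
Lemma serve_first (A : {set T}) (o : ordering A) w :
  serve first_selection o w = remove_first (mem A) w.
Proof. by rewrite /serve; case: ifPn => // /remove_first_id. Qed.

Lemma nonexpansive_first : nonexpansive first_selection (@aligned T).
Proof.
split.
- by move=> A o w; rewrite has_find.
- exact: aligned_nil_r.
- exact: aligned_size.
- exact: aligned_rcons_if.
- by move=> A o n w w' ww; rewrite !serve_first; apply: aligned_remove_first.
Qed.

Lemma last_pos_rev (A : {set T}) w :
  has (mem A) w -> last_pos A w = size w - (find (mem A) (rev w)).+1.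
Proof.
move=> hw; have /hasP[x0 _ _] := hw.
have nthr i : i < size w -> nth x0 (rev w) i = nth x0 w (size w - i.+1).
  exact: nth_rev.
have hr : has (mem A) (rev w) by rewrite has_rev.
have := hr; rewrite has_find size_rev => lt_f.
apply/eqP; rewrite eqn_leq; apply/andP; split.
  apply/bigmax_leqP => m; rewrite (tnth_nth x0) /= => mA; have lt_m := ltn_ord m.
  rewrite leqNgt; apply/negP => gt_m.
  have lt_r : size w - m.+1 < find (mem A) (rev w) by lia.
  have := before_find x0 lt_r; rewrite nthr; last by lia.
  by rewrite (_ : size w - (size w - m.+1).+1 = m) /= ?mA //; lia.
have lt_k : size w - (find (mem A) (rev w)).+1 < size w by lia.
apply: (@leq_bigmax_cond _ _ (fun m => nat_of_ord m) (Ordinal lt_k)).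
by have := nth_find x0 hr; rewrite nthr // (tnth_nth x0).
Qed.

Lemma serve_last (A : {set T}) (o : ordering A) w :
  serve last_selection o w = rev (remove_first (mem A) (rev w)).
Proof.
rewrite /serve; case: ifPn => [hw|hw]; last first.
  by rewrite remove_first_id ?revK ?has_rev.
have := hw; rewrite -has_rev has_find size_rev => lt_f.
rewrite /last_selection last_pos_rev // /remove_first /delete_at.
rewrite rev_cat rev_drop rev_take revK size_rev.
by rewrite subnSK.
Qed.

(** LCFS is FCFS read backwards, and alignments are preserved by reversal. *)
Lemma nonexpansive_last : nonexpansive last_selection (@aligned T).
Proof.
split.
- move=> A o w hw; rewrite /last_selection last_pos_rev //.
  by case: w hw => //= *; lia.
- exact: aligned_nil_r.
- exact: aligned_size.
- exact: aligned_rcons_if.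
- move=> A o n w w' /aligned_rev/(aligned_remove_first (mem A)) [m le_m ww].
  exists m; first by rewrite -(has_rev _ w) -(has_rev _ w').
  by rewrite !serve_last; apply: aligned_rev.
Qed.

End SelectionByAge.

(** * RAND and ML: distance between class counts *)

Section ClassDistance.
Variable T : finType.
Implicit Types (a b : T) (w v : seq T).

Definition class_dist w w' : nat :=
  \sum_a ((count_mem a w - count_mem a w') + (count_mem a w' - count_mem a w)).

Lemma class_dist_sym w w' : class_dist w w' = class_dist w' w.
Proof. by apply: eq_bigr => a _; rewrite addnC. Qed.

Lemma class_dist_perm w v w' v' :
  perm_eq w v -> perm_eq w' v' -> class_dist w w' = class_dist v v'.
Proof. by move=> /permP wv /permP wv'; apply: eq_bigr => a _; rewrite !wv !wv'. Qed.

Lemma class_dist_cons2 a w w' : class_dist (a :: w) (a :: w') = class_dist w w'.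
Proof. by apply: eq_bigr => b _ /=; rewrite !subnDl. Qed.

Lemma class_dist_cons a w w' :
  if count_mem a w' <= count_mem a w
  then class_dist (a :: w) w' = (class_dist w w').+1
  else (class_dist (a :: w) w').+1 = class_dist w w'.
Proof.
pose gap v b :=
  (count_mem b v - count_mem b w') + (count_mem b w' - count_mem b v).
have distE v : class_dist v w' = gap v a + \sum_(b | b != a) gap v b.
  by rewrite /class_dist (bigD1 a).
rewrite !distE (eq_bigr (gap w)) => [|b /negPf nb]; last first.
  by rewrite /gap /= eq_sym nb.
by rewrite /gap /= eqxx; case: ifP; lia.
Qed.

Lemma size_class_dist w w' : size w <= size w' + class_dist w w'.
Proof.
have sizeE v : size v = \sum_a count_mem a v.
  rewrite -sum1_size (partition_big id predT) //=.
  by apply: eq_bigr => a _; rewrite sum1_count.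
by rewrite !sizeE -big_split; apply: leq_sum => a _ /=; lia.
Qed.

Lemma class_dist_nil_r w : class_dist w [::] = size w.
Proof.
by elim: w => [|a w IH]; [apply: big1 | have := class_dist_cons a w [::]; rewrite IH].
Qed.

Lemma class_dist_rcons_if (b b' : bool) a w w' :
  class_dist (rcons_if b w a) (rcons_if b' w' a) <= class_dist w w' + (b (+) b').
Proof.
have rconsP v : perm_eq (rcons v a) (a :: v) by rewrite perm_rcons.
case: b; case: b' => /=.
- by rewrite (class_dist_perm (rconsP w) (rconsP w')) class_dist_cons2 addn0.
- rewrite (class_dist_perm (rconsP w) (perm_refl w')).
  by have := class_dist_cons a w w'; case: ifP => _ /=; lia.
- rewrite (class_dist_perm (perm_refl w) (rconsP w')) 2!(class_dist_sym w).
  by have := class_dist_cons a w' w; case: ifP; lia.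
- by rewrite addn0.
Qed.

Variable f : selection T.

Definition selects (A : {set T}) (o : ordering A) w a :=
  (a \in A) && (onth w (f o w) == Some a).

Hypothesis f_total : forall (A : {set T}) (o : ordering A) w,
  has (mem A) w -> exists a, selects o w a.

(** What makes two different removals harmless: one of them reduces an excess,
    hence lowers the distance by 1, and the other raises it by at most 1. *)
Hypothesis f_coherent : forall (A : {set T}) (o : ordering A) w w' a a',
  selects o w a -> selects o w' a' ->
  [\/ a = a', count_mem a w' < count_mem a w | count_mem a' w < count_mem a' w'].

Lemma nonexpansive_class : nonexpansive f (fun n w w' => class_dist w w' <= n).
Proof.
have serveP (A : {set T}) (o : ordering A) w : has (mem A) w ->
    exists2 a, selects o w a & perm_eq w (a :: serve f o w).
  move=> hw; have [a sel_a] := f_total o hw; exists a => //.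
  by rewrite /serve hw; apply: perm_delete_at; case/andP: sel_a => _ /eqP.
have one_sided (A : {set T}) (o : ordering A) w w' :
    has (mem A) w -> ~~ has (mem A) w' ->
    class_dist (serve f o w) w' + 1 <= class_dist w w'.
  move=> hw hw'; have [a /andP[aA _] wP] := serveP A o w hw.
  rewrite (class_dist_perm wP (perm_refl w')).
  have -> : class_dist (a :: serve f o w) w' = (class_dist (serve f o w) w').+1.
    have := class_dist_cons a (serve f o w) w'; rewrite (count_memPn _) //.
    by apply: contra hw' => aw'; apply/hasP; exists a.
  by rewrite addn1.
have greedy a a' v v' w w' : perm_eq w (a :: v) -> perm_eq w' (a' :: v') ->
    count_mem a w' < count_mem a w -> class_dist v v' <= class_dist w w'.
  move=> wP wP'; have /permP -> := wP; rewrite /= eqxx add1n ltnS => le_a.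
  rewrite (class_dist_perm wP (perm_refl w')).
  have := class_dist_cons a v w'; rewrite le_a => ->.
  rewrite (class_dist_perm (perm_refl v) wP') !(class_dist_sym v).
  by have := class_dist_cons a' v' v; case: ifP => _; lia.
split.
- move=> A o w /(f_total o)[a /andP[_ /eqP wa]].
  by rewrite -onthTE wa.
- by move=> w; rewrite class_dist_nil_r.
- by move=> n w w' le_n; have := size_class_dist w w'; lia.
- by move=> n b b' a w w' le_n; have := class_dist_rcons_if b b' a w w'; lia.
move=> A o n w w' le_n; exists (class_dist (serve f o w) (serve f o w')) => //.
apply: leq_trans le_n.
have [hw|hw] := boolP (has _ w); have [hw'|hw'] := boolP (has _ w') => /=.
- have [a sel_a wP] := serveP A o w hw; have [a' sel_a' wP'] := serveP A o w' hw'.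
  rewrite addn0; case: (f_coherent sel_a sel_a') => [eq_a|lt_a|lt_a'].
  + by rewrite (class_dist_perm wP wP') eq_a class_dist_cons2.
  + exact: greedy wP wP' lt_a.
  + by rewrite class_dist_sym (class_dist_sym w); apply: greedy wP' wP lt_a'.
- by rewrite {2}/serve (negPf hw') one_sided.
- by rewrite {1}/serve (negPf hw) class_dist_sym (class_dist_sym w) one_sided.
- by rewrite /serve (negPf hw) (negPf hw') addn0.
Qed.

End ClassDistance.

(** Selections that take an item of the first class of the list satisfying some
    criterion [eligible], which may depend on the word. *)
Section SelectionByList.
Variables (T : finType) (r : seq T -> T -> nat).
Hypothesis rP : item_rule r.

Lemma find_index_ordering (A : {set T}) (o : ordering A) (p : pred T) :
  (exists2 a, a \in A & p a) ->
  exists a, [/\ a \in A, p a, onth (val o) (find p (val o)) = Some a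
              & find p (val o) = index a (val o)].
Proof.
move=> [b bA pb]; have oA x : (x \in val o) = (x \in A).
  by rewrite (perm_mem (valP o)) mem_enum.
have o_uniq : uniq (val o) by rewrite (perm_uniq (valP o)) enum_uniq.
have hp : has p (val o) by apply/hasP; exists b; rewrite ?oA.
have lt_f := hp; rewrite has_find in lt_f.
exists (nth b (val o) (find p (val o))); split.
- by rewrite -oA mem_nth.
- exact: nth_find.
- by rewrite onthE (nth_map b).
- by rewrite index_uniq.
Qed.

Variable eligible : {set T} -> seq T -> pred T.

Definition list_selection : selection T :=
  fun A o w => pos_of_first r o (eligible A w) w.

Hypothesis eligible_exists : forall (A : {set T}) w,
  has (mem A) w -> exists2 a, a \in A & eligible A w a.
Hypothesis eligible_mem : forall (A : {set T}) w a,
  has (mem A) w -> eligible A w a -> a \in w.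
(** In the first case, each of the two classes precedes the other in the list,
    so that they are equal. *)
Hypothesis eligible_or_lt : forall (A : {set T}) w w' a a',
  a \in A -> a' \in A -> eligible A w a -> eligible A w' a' ->
  [\/ eligible A w a' /\ eligible A w' a,
      count_mem a w' < count_mem a w | count_mem a' w < count_mem a' w'].

Lemma list_selectionP (A : {set T}) (o : ordering A) w : has (mem A) w ->
  exists a, [/\ a \in A, eligible A w a, onth w (list_selection o w) = Some a
              & find (eligible A w) (val o) = index a (val o)].
Proof.
move=> hw.
have [a [aA el_a o_a idx_a]] := find_index_ordering o (eligible_exists hw).
exists a; split => //.
by rewrite /list_selection /pos_of_first o_a /= rP // (eligible_mem hw el_a).
Qed.

Lemma nonexpansive_list :
  nonexpansive list_selection (fun n w w' => class_dist w w' <= n).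
Proof.
apply: nonexpansive_class => [A o w hw|A o w w' a a'].
  by have [a [aA _ w_a _]] := list_selectionP o hw; exists a; rewrite /selects aA w_a /=.
have selectsE v b : selects list_selection o v b ->
    [/\ b \in A, eligible A v b & find (eligible A v) (val o) = index b (val o)].
  move=> /andP[bA /eqP v_b].
  have hv : has (mem A) v by apply/hasP; exists b => //; apply/onthP; eexists; exact: v_b.
  by have [b' [b'A el_b']] := list_selectionP o hv; rewrite v_b => -[->].
move=> /selectsE[aA el_a idx_a] /selectsE[a'A el_a' idx_a'].
case: (eligible_or_lt aA a'A el_a el_a') => [[el_wa' el_w'a]|lt|lt].
- constructor 1.
  have find_le v b : eligible A v b -> find (eligible A v) (val o) <= index b (val o).
    by move=> el_b; apply: sub_find => x /eqP ->.
  have oA x : x \in A -> x \in val o by rewrite (perm_mem (valP o)) mem_enum.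
  apply: (index_inj a (oA _ aA) (oA _ a'A)); apply/eqP.
  by rewrite /= eqn_leq -{1}idx_a -{2}idx_a' !find_le.
- by constructor 2.
- by constructor 3.
Qed.

End SelectionByList.

Definition present (T : finType) (A : {set T}) (w : seq T) : pred T := mem w.

Definition longest (T : finType) (A : {set T}) (w : seq T) : pred T :=
  fun a => [forall b in A, count_mem b w <= count_mem a w].

(** A class present in one word and absent from the other is in excess. *)
Lemma nonexpansive_rand (T : finType) (r : seq T -> T -> nat) :
  item_rule r ->
  nonexpansive (list_selection r (@present T)) (fun n w w' => class_dist w w' <= n).
Proof.
move=> rP; apply: nonexpansive_list => //.
- by move=> A w /hasP[a aw aA]; exists a.
- move=> A w w' a a' _ _ aw a'w'; rewrite /present /=.
  have [aw'|naw'] := boolP (a \in w'); last first.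
    by constructor 2; rewrite (count_memPn naw') -has_count has_pred1.
  have [a'w|na'w] := boolP (a' \in w); last first.
    by constructor 3; rewrite (count_memPn na'w) -has_count has_pred1.
  by constructor 1.
Qed.

(** If neither class is in excess, then going round the two words and the two
    classes gives a cycle of inequalities: all four counts are equal, and both
    classes are longest in both words. *)
Lemma nonexpansive_longest (T : finType) (r : seq T -> T -> nat) :
  item_rule r ->
  nonexpansive (list_selection r (@longest T)) (fun n w w' => class_dist w w' <= n).
Proof.
move=> rP; apply: nonexpansive_list => //.
- move=> A w /hasP[a0 _ a0A].
  have [a aA max_a] := @arg_maxnP _ a0 (mem A) (fun a => count_mem a w) a0A.
  by exists a => //; apply/forall_inP.
- move=> A w a /hasP[b bw bA] /forall_inP/(_ b bA) le_ba.
  by rewrite -has_pred1 has_count (leq_trans _ le_ba) // -has_count has_pred1.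
- move=> A w w' a a' aA a'A max_a max_a'.
  have le_a'a := forall_inP max_a a' a'A; have le_aa' := forall_inP max_a' a aA.
  have [|le_a] := ltnP (count_mem a w') (count_mem a w); first by constructor 2.
  have [|le_a'] := ltnP (count_mem a' w) (count_mem a' w'); first by constructor 3.
  constructor 1; split; apply/forall_inP => b bA.
    by apply: leq_trans (forall_inP max_a b bA) _; lia.
  by apply: leq_trans (forall_inP max_a' b bA) _; lia.
Qed.

Theorem proposition1 (C S : finType) (E F : {set C * S}) :
  matching_structure E F ->
  [/\ subadditive (@FCFS C S E),
      subadditive (@LCFS C S E),
      forall (rC : seq C -> C -> nat) (rS : seq S -> S -> nat),
        item_rule rC -> item_rule rS -> subadditive (@RAND C S E rC rS)
    & forall (rC : seq C -> C -> nat) (rS : seq S -> S -> nat),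
        item_rule rC -> item_rule rS -> subadditive (@ML C S E rC rS)].
Proof.
move=> _; split.
- exact: (subadditive_side_policy (nonexpansive_first C) (nonexpansive_first S)).
- exact: (subadditive_side_policy (nonexpansive_last C) (nonexpansive_last S)).
- move=> rC rS rCP rSP.
  exact: (subadditive_side_policy (nonexpansive_rand rCP) (nonexpansive_rand rSP)).
- move=> rC rS rCP rSP.
  exact: (subadditive_side_policy (nonexpansive_longest rCP)
                                  (nonexpansive_longest rSP)).
Qed.
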